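(* Let $n$ be a positive integer and let $\{a,b\}$ be a $2$-element subset of $\mathbb{Z}_n$. Then $\{a,b\}$ is index stable in $\mathbb{Z}_n$ if and only if $$\frac{n}{\gcd(n,a-b)}\in\{2,3,4,5,7\}.$$
   Context: $\mathbb{Z}_n=\{0,1,\ldots,n-1\}$ is the group of least nonnegative residues modulo $n$ under addition modulo $n$; sums and differences of subsets are taken in this group, so $A-A=\{a-a' : a,a'\in A\}$, etc. Let $A$ be a non-empty subset of $\mathbb{Z}_n$. A subset $B\subseteq\mathbb{Z}_n$ is called a subfactor of $\mathbb{Z}_n$ relative to $A$ if $(A-A)\cap(B-B)=\{0\}$ and $(A-A)+B=\mathbb{Z}_n$. The lower subindex $|\mathbb{Z}_n:A|^-$ (resp. upper subindex $|\mathbb{Z}_n:A|^+$) is the minimum (resp. maximum) of $|B|$ over all subfactors $B$ of $\mathbb{Z}_n$ relative to $A$. The set $A$ is called index stable (in $\mathbb{Z}_n$) if $|\mathbb{Z}_n:A|^-=|\mathbb{Z}_n:A|^+$. In $\gcd(n,a-b)$, the difference $a-b$ is the difference of the integers $a,b\in\{0,\ldots,n-1\}$ (taking it modulo $n$ gives the same gcd). *)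

(* Defs.v *)
From HB Require Import structures.
From mathcomp Require Import all_boot all_order all_algebra.

Set Implicit Arguments.
Unset Strict Implicit.
Unset Printing Implicit Defensive.

Import GRing.Theory.
Local Open Scope ring_scope.

Section Subfactors.
Variable G : finZmodType.
Implicit Types A B : {set G}.

Definition sumset A B : {set G} := [set x + y | x in A, y in B].
Definition diffset A B : {set G} := [set x - y | x in A, y in B].

Definition subfactor A B : bool :=
  (diffset A A :&: diffset B B == [set 0])
  && (sumset (diffset A A) B == [set: G]).

(* The neutral element #|G| bounds every #|B|, and subfactors exist whenever A
   is non-empty, so these are the actual minimum and maximum; see
   [lower_subindexP] and [upper_subindexP]. *)
Definition lower_subindex A : nat :=
  \big[minn/#|G|]_(B : {set G} | subfactor A B) #|B|.
Definition upper_subindex A : nat :=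
  (\max_(B : {set G} | subfactor A B) #|B|)%N.

Definition index_stable A : Prop := lower_subindex A = upper_subindex A.

Lemma diffset0 A : A != set0 -> 0 \in diffset A A.
Proof.
by case/set0Pn=> x Ax; apply/imset2P; exists x x; rewrite ?subrr.
Qed.

Lemma diffsetN A x : x \in diffset A A -> - x \in diffset A A.
Proof.
by case/imset2P=> u v Au Av ->; apply/imset2P; exists v u; rewrite ?opprB.
Qed.

Lemma subfactor_exists A : A != set0 -> exists B, subfactor A B.
Proof.
move=> An0; have A0 := diffset0 An0.
pose P B := diffset A A :&: diffset B B == [set 0].
have P0 : P [set 0].
  rewrite /P; apply/eqP/setP=> x; rewrite !inE; apply/andP/eqP.
    by case=> _ /imset2P[u v /set1P-> /set1P-> ->]; rewrite subrr.
  by move=> ->; split=> //; apply/diffset0/set0Pn; exists 0; rewrite inE.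
have [B /maxsetP[PB maxB] _] := maxset_exists P0.
exists B; rewrite /subfactor [_ == _]PB /=.
apply/eqP/setP=> x; rewrite inE; apply: contraT => xN.
have xBN y : y \in B -> x - y \notin diffset A A.
  move=> By; apply: contra xN => xy.
  by apply/imset2P; exists (x - y) y; rewrite ?subrK.
have PxB : P (x |: B).
  rewrite /P; apply/eqP/setP=> z; rewrite in_setI in_set1; apply/andP/eqP.
    case=> Az /imset2P[u v /setU1P[->|Bu] /setU1P[->|Bv] zE].
    - by rewrite zE subrr.
    - by move: (xBN v Bv); rewrite -zE Az.
    - by move: (xBN u Bu); rewrite -opprB -zE diffsetN.
    - apply/set1P; rewrite -(eqP PB) in_setI Az zE.
      by apply/imset2P; exists u v.
  by move=> ->; split=> //; apply/diffset0/set0Pn; exists x; rewrite setU11.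
have xB : x \in B by rewrite -(maxB _ PxB (subsetUr _ _)) setU11.
by move: (xBN x xB); rewrite subrr A0.
Qed.

Lemma lower_subindexP A : A != set0 ->
  (exists2 B, subfactor A B & #|B| = lower_subindex A)
  /\ (forall B, subfactor A B -> (lower_subindex A <= #|B|)%N).
Proof.
case/subfactor_exists=> B0 sB0.
have le B : subfactor A B -> (lower_subindex A <= #|B|)%N.
  move=> sB; rewrite /lower_subindex.
  elim: (index_enum _) (mem_index_enum B) => // C r IHr.
  rewrite big_cons inE => /predU1P[<-|/IHr leB]; first by rewrite sB geq_minl.
  by case: ifP => // _; rewrite geq_min leB orbT.
split=> //; have [B sB minB] := @arg_minnP _ B0 (subfactor A) (fun B => #|B|) sB0.
exists B => //; apply/eqP; rewrite eqn_leq le // andbT /lower_subindex.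
elim/big_ind: _ => [|m n Bm Bn|C sC]; first exact: max_card.
  by rewrite leq_min Bm.
exact: minB.
Qed.

Lemma upper_subindexP A : A != set0 ->
  (exists2 B, subfactor A B & #|B| = upper_subindex A)
  /\ (forall B, subfactor A B -> (#|B| <= upper_subindex A)%N).
Proof.
case/subfactor_exists=> B0 sB0.
split=> [|B sB]; last exact: leq_bigmax_cond.
have [|B sB e] := @eq_bigmax_cond _ (subfactor A) (fun B => #|B|).
  by apply/card_gt0P; exists B0.
by exists B.
Qed.

End Subfactors.

(* Main.v *)
(* For d = a - b, a subfactor relative to {a, b} is a maximal independent set of
   the Cayley graph of Z_n with steps +d and -d, a disjoint union of cycles of
   length m = n / gcd(n, a - b).  Such a set meets a cycle of length m in s points
   with m / 3 <= s <= m / 2, which determines s when m is 2, 3, 4, 5 or 7.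
   Otherwise m = 3 c + 2 j in two ways with different c + j, and a cycle has a
   maximal independent set with c gaps of length 3 and j gaps of length 2. *)
Require Import Defs.
From mathcomp Require Import all_boot all_order all_algebra.
From mathcomp Require Import all_fingroup all_solvable.
From mathcomp Require Import zify.
Import GRing.Theory FinRing.Theory.
Local Open Scope ring_scope.

(** * Independent dominating sets on one cycle *)

Lemma sum_periodic (F : nat -> nat) (m i : nat) :
  (forall k, F (m + k) = F k)%N ->
  (\sum_(k < m) F (i + k) = \sum_(k < m) F k)%N.
Proof.
move=> perF; elim: i => [//|i <-].
case: m perF => [|m] perF; first by rewrite !big_ord0.
rewrite big_ord_recr big_ord_recl /= addn0 addnC.
have -> : (i.+1 + m = m.+1 + i)%N by lia.
by rewrite perF; congr addn; apply: eq_bigr => k _; rewrite /bump addSnnS.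
Qed.

(** Double counting: the cyclic windows of length 2 (resp. 3) count each chosen point twice (resp.
    three times), while every 2-window holds at most one chosen point and every 3-window at least
    one. *)
Lemma sum_cyclic_mis (f : nat -> bool) (m : nat) :
  (forall k, f (m + k)%N = f k) ->
  (forall k, ~~ (f k && f k.+1)) ->
  (forall k, [|| f k, f k.+1 | f k.+2]) ->
  (2 * \sum_(k < m) f k <= m)%N /\ (m <= 3 * \sum_(k < m) f k)%N.
Proof.
move=> perf indep dom; pose F k : nat := f k.
have perF k : F (m + k)%N = F k by rewrite /F perf.
have sh i := sum_periodic F m i perF.
have cst : (\sum_(k < m) 1 = m)%N by rewrite sum1_card card_ord.
have two : (2 * \sum_(k < m) f k = \sum_(k < m) (F k + F (1 + k)))%N.
  by rewrite big_split /= (sh 1%N) addnn mul2n.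
have three : (3 * \sum_(k < m) f k = \sum_(k < m) (F k + F (1 + k) + F (2 + k)))%N.
  by rewrite !big_split /= (sh 1%N) (sh 2%N) addnn -mul2n -mulSnr.
rewrite two three; split.
  rewrite -[X in (_ <= X)%N]cst; apply: leq_sum => k _; have := indep k.
  by rewrite /F add1n; case: (f k); case: (f k.+1).
rewrite -[X in (X <= _)%N]cst; apply: leq_sum => k _; have := dom k.
by rewrite /F add1n add2n; case: (f k); case: (f k.+1); case: (f k.+2).
Qed.

Lemma eq_half_of_bounds (m s : nat) : m \in [:: 2; 3; 4; 5; 7]%N ->
  (2 * s <= m)%N -> (m <= 3 * s)%N -> s = m./2.
Proof. by rewrite !inE => /or4P[|||/orP[]] /eqP ->; lia. Qed.

(* On the cycle of length 3 c + 2 j: gaps of length 3 first, then of length 2. *)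
Definition gap_pattern (c k : nat) : bool :=
  if (k < 3 * c)%N then (3 %| k)%N else ~~ odd (k - 3 * c).

Lemma gap_pattern_indep (c j k : nat) : (1 < 3 * c + 2 * j)%N ->
  (k < 3 * c + 2 * j)%N ->
  ~~ (gap_pattern c k && gap_pattern c (k.+1 %% (3 * c + 2 * j))).
Proof.
move=> m1 km; have [e|ne] := eqVneq k.+1 (3 * c + 2 * j)%N.
  (* The successor wraps to 0; the last position ends a gap of length 2 or 3, so it is not
     chosen. *)
  by rewrite e modnn /gap_pattern; do !case: ifP; lia.
by rewrite modn_small /gap_pattern; do ?case: ifP; lia.
Qed.

(** Gaps have length at most 3, and a window that wraps around contains position 0, which is always
    chosen. *)
Lemma gap_pattern_dom (c j k : nat) : (1 < 3 * c + 2 * j)%N ->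
  (k < 3 * c + 2 * j)%N ->
  [|| gap_pattern c k, gap_pattern c (k.+1 %% (3 * c + 2 * j))
    | gap_pattern c (k.+2 %% (3 * c + 2 * j))].
Proof.
move=> m1 km; have [e|ne] := eqVneq k.+1 (3 * c + 2 * j)%N.
  by rewrite e modnn /gap_pattern; do !case: ifP; lia.
rewrite (modn_small (m := k.+1)); last by lia.
have [e|ne2] := eqVneq k.+2 (3 * c + 2 * j)%N.
  by rewrite e modnn /gap_pattern; do !case: ifP; lia.
by rewrite modn_small /gap_pattern; do ?case: ifP; lia.
Qed.

Lemma sum_gap_pattern (c j : nat) :
  (\sum_(k < 3 * c + 2 * j) gap_pattern c k = c + j)%N.
Proof.
elim: j => [|j IHj]; last first.
  have -> : (3 * c + 2 * j.+1 = (3 * c + 2 * j).+2)%N by lia.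
  rewrite !big_ord_recr /= IHj /gap_pattern.
  by do !case: ifP; lia.
have -> : (3 * c + 2 * 0 = 3 * c)%N by lia.
rewrite addn0 (eq_bigr (fun k : 'I_(3 * c) => (3 %| k)%N : nat)); last first.
  by move=> k _; rewrite /gap_pattern ltn_ord.
elim: c => [|c IHc]; first by rewrite muln0 big_ord0.
have -> : (3 * c.+1 = (3 * c).+3)%N by lia.
by rewrite !big_ord_recr /= IHc; lia.
Qed.

(** * Counting and positions along the cosets of a cyclic subgroup *)

Section Cosets.
Variable G : finZmodType.
Implicit Types (d x : G) (B : {set G}).

(** After exchanging the sums, each [k] counts a translate of [B]. Letting every [x] start a walk
    avoids choosing one start per coset. *)
Lemma sum_cycle_card d B (m : nat) :
  (\sum_(x : G) \sum_(k < m) ((x + d *+ k)%R \in B) = m * #|B|)%N.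
Proof.
rewrite exchange_big /= (eq_bigr (fun=> #|B|)); last first.
  move=> k _; rewrite -sum1_card [RHS](reindex_inj (addIr (d *+ k))) [RHS]big_mkcond.
  by apply: eq_bigr => x _; case: (_ \in _).
by rewrite sum_nat_const card_ord.
Qed.

(** [kappa x] is the position of [x] on its cycle, counted in steps of [d] from a chosen
    representative of its coset of [<[d]>]. *)
Lemma cycle_index d : exists kappa : G -> nat,
  (forall x, kappa x < #[d]%g)%N
  /\ (forall x, kappa (x + d)%R = (kappa x).+1 %% #[d]%g)%N.
Proof.
pose rep x : G := repr (<[d]> :* x)%g.
have ex x : exists i : 'I_(#[d]%g), x == rep x + d *+ i.
  have /rcosetP[y yd e] := mem_repr_rcoset <[d]>%G x.
  have [i lti ei] : {i : nat | (i < #[d]%g)%N & (- y : G) = d *+ i}.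
    by apply: cyclePmin; apply: groupVr.
  exists (Ordinal lti); rewrite /= -ei [rep x]e zmodMgE.
  by rewrite [y + x]addrC addrK.
have [kappa kappaE] : exists kappa : G -> 'I_(#[d]%g), forall x, x = rep x + d *+ kappa x.
  by exists (fun x => xchoose (ex x)) => x; apply/eqP/(xchooseP (ex x)).
exists (fun x => nat_of_ord (kappa x)); split=> [x|x]; first exact: ltn_ord.
have := kappaE (x + d).
have -> : rep (x + d) = rep x.
  rewrite /rep; congr repr; apply/rcoset_eqP/rcosetP.
  by exists d; rewrite ?cycle_id // zmodMgE addrC.
(* Cancelling the common representative leaves two equal multiples of [d], so their coefficients
   agree modulo the order of [d]. *)
rewrite {1}[x]kappaE -addrA -mulrSr => /addrI/eqP.
rewrite -!zmodXgE eq_expg_mod_order => /eqP ->.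
by rewrite modn_small.
Qed.

End Cosets.

(** * Subfactors relative to a two-element set *)

Section Pairs.
Variables (G : finZmodType) (a b : G).
Hypothesis neq_ab : a != b.
Let d := a - b.

Lemma diffset_pair z :
  (z \in diffset [set a; b] [set a; b]) = [|| z == 0, z == d | z == - d].
Proof.
apply/imset2P/or3P.
  case=> u v /set2P[->|->] /set2P[->|->] ->; rewrite ?subrr.
  - by apply: Or31.
  - by apply: Or32.
  - by apply: Or33; rewrite opprB.
  - by apply: Or31.
case=> /eqP->.
- by exists a a; rewrite ?subrr ?set21.
- by exists a b; rewrite ?set21 ?set22.
- by exists b a; rewrite ?set21 ?set22 // opprB.
Qed.

(** Covering is read at [x + d] rather than at [x], so that the window runs forward from [x] as in
    [sum_cyclic_mis]. *)
Lemma subfactor_pairP (B : {set G}) :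
  reflect ((forall x, ~~ ((x \in B) && (x + d \in B)))
           /\ (forall x, [|| x \in B, x + d \in B | x + d + d \in B]))
    (subfactor [set a; b] B).
Proof.
have dN0 : d != 0 by rewrite subr_eq0.
apply: (iffP andP) => [[/eqP/setP indep /eqP/setP cover]|[indep dom]]; split.
- move=> x; apply/andP=> -[Bx Bxd]; have := indep d.
  rewrite in_setI diffset_pair eqxx orbT in_set1 (negPf dN0) /=.
  by move/imset2P; apply; exists (x + d) x; rewrite // addrC addKr.
- move=> x; have := cover (x + d); rewrite in_setT => /imset2P[u v].
  rewrite diffset_pair => /or3P[] /eqP-> Bv e; apply/or3P.
  + by apply: Or32; rewrite e add0r.
  + by apply: Or31; move: e; rewrite addrC => /addrI->.
  + by apply: Or33; rewrite e addrC addrA subrr add0r.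
(* A point of [B] is needed to put 0 in the difference set of [B]. *)
- have [y By] : exists y, y \in B.
    by have /or3P[] := dom 0; [exists 0 | exists (0 + d) | exists (0 + d + d)].
  apply/eqP/setP=> z; rewrite in_setI diffset_pair in_set1.
  have [->|zN0] /= := eqVneq z 0.
    by apply/imset2P; exists y y; rewrite ?subrr.
  apply/andP=> -[/orP[]/eqP ze /imset2P[u v Bu Bv e]].
  + by have := indep v; rewrite Bv -ze e addrC subrK Bu.
  + have := indep u; rewrite Bu -[d]opprK -ze e opprB.
    by rewrite addrC subrK Bv.
- apply/eqP/setP=> x; rewrite in_setT; apply/imset2P.
  have := dom (x - d); rewrite !subrK => /or3P[] Bx.
  + by exists d (x - d); rewrite ?diffset_pair ?eqxx ?orbT // addrC subrK.
  + by exists 0 x; rewrite ?diffset_pair ?eqxx // add0r.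
  + by exists (- d) (x + d); rewrite ?diffset_pair ?eqxx ?orbT // addrC addrK.
Qed.

(** Every cycle meets [B] in [#[d]%g./2] points; summing over all starting points fixes [#|B|]
    without division. *)
Lemma card_subfactor_pair (B : {set G}) :
  #[d]%g \in [:: 2; 3; 4; 5; 7]%N -> subfactor [set a; b] B ->
  (#[d]%g * #|B| = #|G| * #[d]%g./2)%N.
Proof.
move=> md /subfactor_pairP[indep dom].
rewrite -(sum_cycle_card G d) (eq_bigr (fun=> #[d]%g./2)).
  by rewrite sum_nat_const.
move=> x _; have [k|k|k|] := sum_cyclic_mis (fun k => x + d *+ k \in B) #[d]%g.
- rewrite mulrnDr.
  by have /= := expg_order d; rewrite zmodXgE => ->; rewrite add0r.
- by rewrite mulrSr addrA.
- by have := dom (x + d *+ k); rewrite !mulrSr -!addrA.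
exact: eq_half_of_bounds.
Qed.

Lemma gap_subfactor_pair (c j : nat) : #[d]%g = (3 * c + 2 * j)%N ->
  exists2 B, subfactor [set a; b] B & (#[d]%g * #|B| = #|G| * (c + j))%N.
Proof.
move=> md; have m1 : (1 < #[d]%g)%N by rewrite order_gt1 subr_eq0.
have [kappa [ltk kS]] := cycle_index G d.
exists [set x | gap_pattern c (kappa x)].
  have k2 x : kappa (x + d + d) = ((kappa x).+2 %% #[d]%g)%N.
    by rewrite !kS -addn1 modnDml addn1.
  apply/subfactor_pairP; split=> x; rewrite !inE ?k2 kS md.
    by apply: gap_pattern_indep; rewrite -md.
  by apply: gap_pattern_dom; rewrite -md.
rewrite -(sum_cycle_card G d) (eq_bigr (fun=> c + j)%N).
  by rewrite sum_nat_const.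
move=> x _; have kn k : kappa (x + d *+ k) = ((kappa x + k) %% #[d]%g)%N.
  elim: k => [|k IHk]; first by rewrite addr0 addn0 modn_small.
  by rewrite mulrSr addrA kS IHk -addn1 modnDml addn1 addnS.
(* The periodic extension of the pattern: its sum over a full period does not depend on the starting
   position [kappa x]. *)
pose F k : nat := gap_pattern c (k %% #[d]%g).
rewrite (eq_bigr (fun k : 'I__ => F (kappa x + k)%N)); last first.
  by move=> k _; rewrite inE kn.
rewrite sum_periodic => [|k]; last by rewrite /F modnDl.
rewrite -sum_gap_pattern -md; apply: eq_bigr => k _.
by rewrite /F modn_small.
Qed.

Lemma index_stable_pairP :
  index_stable [set a; b] <-> #[d]%g \in [:: 2; 3; 4; 5; 7]%N.
Proof.
have An0 : [set a; b] != set0 by apply/set0Pn; exists a; rewrite set21.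
have m1 : (1 < #[d]%g)%N by rewrite order_gt1 subr_eq0.
have [[L sL cL] minL] := lower_subindexP An0.
have [[U sU cU] maxU] := upper_subindexP An0.
rewrite /index_stable; split=> [st|md]; last first.
  apply/eqP; rewrite -cL -cU -(eqn_pmul2l (ltnW m1)).
  by rewrite !card_subfactor_pair.
apply: contraT => mN.
have cst B : subfactor [set a; b] B -> #|B| = lower_subindex [set a; b].
  by move=> sB; apply/eqP; rewrite eqn_leq minL // st maxU.
(* Trading three gaps of length 2 for two of length 3 keeps the cycle length but lowers the number
   of points by one. *)
have contra_gaps c j : #[d]%g = (3 * c + 2 * j.+3)%N -> False.
  move=> md; have [B sB cB] := gap_subfactor_pair c j.+3 md.
  have [|C sC cC] := gap_subfactor_pair c.+2 j; first by rewrite md; lia.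
  have G0 : (0 < #|G|)%N by apply/card_gt0P; exists a.
  move: cC; rewrite (cst C) // -(cst B) // cB => /eqP.
  by rewrite eqn_pmul2l //; lia.
move: mN; rewrite !inE => mN.
(* Outside the list, an odd order is at least 9 and equals 3 plus at least three 2's; an even one is
   at least 6, a sum of at least three 2's. *)
have := odd_double_half #[d]%g; case: (odd _) => me.
  by case: (contra_gaps 1%N (#[d]%g./2 - 4)%N); lia.
by case: (contra_gaps 0%N (#[d]%g./2 - 3)%N); lia.
Qed.

End Pairs.

(** * From the order of a residue to the gcd of integers *)

Lemma gcdn_ord_sub (n : nat) (a b : 'I_n.+1) :
  gcdn n.+1 (a - b)%R = gcdn n.+1 `|(a : nat)%:Z - (b : nat)%:Z|%N.
Proof.
rewrite /= modnDmr gcdn_modr.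
have [ba|ab] := leqP b a.
  have -> : (a + (n.+1 - b) = (a - b) + n.+1)%N by have := ltn_ord b; lia.
  by rewrite gcdnDr; congr gcdn; lia.
have -> : `|(a : nat)%:Z - (b : nat)%:Z|%N = (b - a)%N by lia.
(* For [a < b] the residue of [a - b] and the integer [b - a] add up to the modulus, hence have the
   same gcd with it. *)
have gcd_compl v w : gcdn (v + w) v = gcdn (v + w) w.
  by rewrite gcdnC gcdnDl [RHS]gcdnC gcdnDr gcdnC.
have := gcd_compl (a + (n.+1 - b))%N (b - a)%N.
by have -> : (a + (n.+1 - b) + (b - a) = n.+1)%N by have := ltn_ord b; lia.
Qed.

(** The residue [a - b] is a multiple of the generator 1, which has order [n.+1]. *)
Lemma order_ord_sub (n : nat) (a b : 'I_n.+1) :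
  #[a - b]%g = (n.+1 %/ gcdn n.+1 `|(a : nat)%:Z - (b : nat)%:Z|)%N.
Proof.
by rewrite -[a - b]Zp1_expgz orderXgcd order_Zp1 gcdn_ord_sub.
Qed.

Theorem corollary2p8 (n : nat) (a b : 'I_n.+1) (hab : a != b) :
  index_stable [set a; b] <->
  (n.+1 %/ gcdn n.+1 `|(a : nat)%:Z - (b : nat)%:Z|)%N \in [:: 2; 3; 4; 5; 7]%N.
Proof. by rewrite -order_ord_sub; apply: index_stable_pairP. Qed.
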